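(* Let $n = 2^k$. Then ExternalWeakHeapsort performs exactly the same comparisons as top-down Mergesort applied to a fixed permutation of the same input array; that is, there is a permutation $\pi$ of $\{0,\dots,n-1\}$, depending only on $n$, such that for every array $s_0,\dots,s_{n-1}$ of pairwise distinct elements, ExternalWeakHeapsort on $s$ performs exactly the same comparisons as top-down Mergesort on $(s_{\pi(0)},\dots,s_{\pi(n-1)})$.
   Context: Weak heap: array $s_0,\dots,s_{n-1}$ with reverse bits $r_0,\dots,r_{n-1}\in\{0,1\}$. The left child of index $i$ is $2i+r_i$, the right child is $2i+1-r_i$, the parent of $i\neq 0$ is $\lfloor i/2\rfloor$; the root $0$ has no left child. The weak-heap order requires each node's element to be $\le$ every element in its right subtree. The distinguished ancestor d-ancestor$(j)$ of $j\ne 0$ is the parent of $j$ if $j$ is a right child, and d-ancestor of the parent of $j$ if $j$ is a left child. join$(i,j)$: compare $s_j$ with $s_i$; if $s_j<s_i$, swap $s_i,s_j$ and set $r_j\leftarrow 1-r_j$. Construction: with all $r_i=0$, for $j=n-1$ down to $1$ perform join(d-ancestor$(j)$, $j$) ($n-1$ comparisons). ExternalWeakHeapsort: after construction, additionally maintain active bits (initially all true; inactive nodes are considered removed). Until the heap is empty: move the root element to the next position of a separate output array, and fill the hole at the root as follows (hole filling at a node $v$ that roots a weak heap): follow the special path from $v$, going once to the right child and then to left children as far as possible (among active nodes), reaching a node $x$ without left child (no comparisons needed); move $s_x$ to $v$; if $x$ has a right subtree, fill the hole at $x$ recursively in the weak heap rooted at $x$, otherwise set the active bit of $x$ to false; then,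 going upwards along the special path, join each node $y$ on the special path strictly between $v$ and $x$ with its distinguished ancestor $v$ (i.e. perform join$(v,y)$ from the bottommost such $y$ to the topmost). Top-down Mergesort on an array of length $m>1$: recursively sort the left half and the right half, then merge them by repeatedly comparing the smallest remaining elements of both halves and moving the smaller one to the output, until one half is exhausted. *)

(* Defs.v *)
From mathcomp Require Import all_boot all_order.
From mathcomp Require Import fingroup perm.
Set Implicit Arguments.
Unset Strict Implicit.
Unset Printing Implicit Defensive.
Import Order.TTheory.
Local Open Scope order_scope.

(* A comparison between two elements is recorded as an unordered pair,
   normalised as (smaller, larger). *)
Definition npair {d} {T : orderType d} (x y : T) : T * T :=
  if x < y then (x, y) else (y, x).

Section Mergesort.
Context {d} {T : orderType d}.

Fixpoint merge_tr (l1 l2 : seq T) {struct l1} : seq T * seq (T * T) :=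
  match l1 with
  | [::] => (l2, [::])
  | x :: l1' =>
    (fix mrg2 (l2 : seq T) : seq T * seq (T * T) :=
       match l2 with
       | [::] => (l1, [::])
       | y :: l2' =>
         if x < y then
           let: (o, t) := merge_tr l1' l2 in (x :: o, npair x y :: t)
         else
           let: (o, t) := mrg2 l2' in (y :: o, npair x y :: t)
       end) l2
  end.

(* fuel-bounded recursion; fuel = size of the list is always enough *)
Fixpoint msort_tr (fuel : nat) (l : seq T) : seq T * seq (T * T) :=
  match fuel with
  | 0 => (l, [::])
  | f.+1 =>
    if size l <= 1 then (l, [::]) else
    let m := (size l) %/ 2 in
    let: (sl, tl) := msort_tr f (take m l) in
    let: (sr, tr) := msort_tr f (drop m l) in
    let: (o, tm) := merge_tr sl sr in
    (o, tl ++ tr ++ tm)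
  end.

Definition mergesort_trace (l : seq T) : seq (T * T) := (msort_tr (size l) l).2.

End Mergesort.

Section WeakHeap.
Context {d} {T : orderType d} (x0 : T) (n : nat).

(* array s, reverse bits r, active bits a, comparisons performed so far *)
Record whstate := WHState {
  wh_s : seq T; wh_r : seq bool; wh_a : seq bool; wh_tr : seq (T * T) }.

Definition get (st : whstate) i := nth x0 (wh_s st) i.
Definition rbit (st : whstate) i := nth false (wh_r st) i.
Definition abit (st : whstate) i := nth false (wh_a st) i.

Definition leftc (st : whstate) i := (2 * i + rbit st i)%N.
Definition rightc (st : whstate) i := (2 * i + 1 - rbit st i)%N.
Definition parent (j : nat) := (j %/ 2)%N.
Definition is_leftc (st : whstate) j := j == leftc st (parent j).

Definition join (st : whstate) (i j : nat) : whstate :=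
  let si := get st i in let sj := get st j in
  let tr := rcons (wh_tr st) (npair si sj) in
  if sj < si then
    WHState (set_nth x0 (set_nth x0 (wh_s st) i sj) j si)
            (set_nth false (wh_r st) j (~~ rbit st j)) (wh_a st) tr
  else WHState (wh_s st) (wh_r st) (wh_a st) tr.

(* distinguished ancestor of j <> 0 (fuel j suffices) *)
Fixpoint dancestor (fuel : nat) (st : whstate) (j : nat) : nat :=
  match fuel with
  | 0 => parent j
  | f.+1 => if is_leftc st j then dancestor f st (parent j) else parent j
  end.

Definition init_state (l : seq T) : whstate :=
  WHState l (nseq n false) (nseq n true) [::].

Definition construct (st : whstate) : whstate :=
  foldl (fun st j => join st (dancestor j st j) j) st (rev (iota 1 n.-1)).

(* existence of (active) children; the root 0 has no left child *)
Definition has_left (st : whstate) i :=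
  [&& i != 0%N, (leftc st i < n)%N & abit st (leftc st i)].
Definition has_right (st : whstate) i :=
  ((rightc st i < n)%N && abit st (rightc st i)).

Definition write (st : whstate) i x :=
  WHState (set_nth x0 (wh_s st) i x) (wh_r st) (wh_a st) (wh_tr st).
Definition deactivate (st : whstate) i :=
  WHState (wh_s st) (wh_r st) (set_nth false (wh_a st) i false) (wh_tr st).

Fixpoint lpath (fuel : nat) (st : whstate) (y : nat) : seq nat :=
  match fuel with
  | 0 => [:: y]
  | f.+1 => if has_left st y then y :: lpath f st (leftc st y) else [:: y]
  end.

Fixpoint fill (fuel : nat) (st : whstate) (v : nat) : whstate :=
  match fuel with
  | 0 => st
  | f.+1 =>
    if ~~ has_right st v then deactivate st v else
    let p := lpath n st (rightc st v) in
    let x := last v p in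
    let mid := take (size p).-1 p in
    let st1 := write st v (get st x) in
    let st2 := if has_right st1 x then fill f st1 x else deactivate st1 x in
    foldl (fun st y => join st v y) st2 (rev mid)
  end.

Fixpoint extract (fuel : nat) (st : whstate) : whstate :=
  match fuel with
  | 0 => st
  | f.+1 => if abit st 0 then extract f (fill n st 0) else st
  end.

End WeakHeap.

Definition weakheapsort_trace {d} {T : orderType d} (l : seq T) : seq (T * T) :=
  match l with
  | [::] => [::]
  | x0 :: _ =>
    let n := size l in
    wh_tr (extract x0 n n (construct x0 n (init_state n l)))
  end.

(* Main.v *)
Require Import Defs.
From mathcomp Require Import all_boot all_order.
From mathcomp Require Import fingroup perm.
From mathcomp Require Import zify.
(* A weak heap is a merge tree in the middle of a lazy mergesort. The nodes
   1, ..., n - 1 of the heap are the internal nodes of a complete binary merge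
   tree. The merge at [j] has as its inputs the outputs of its left child, whose
   current head is stored at the distinguished ancestor of [j], and of its right
   child, whose current head is [s_j]. A join at [j] is one comparison of this
   merge; when [s_j] wins, flipping the reverse bit exchanges the roles of the two
   inputs, which is harmless because merging lists without common elements is
   commutative, also as regards the comparisons performed. Filling a hole asks for
   the next output of the merge, and a missing left subtree is an exhausted input,
   in which case no comparison takes place. Hence the comparisons already performed
   together with those still needed to run all pending merges to completion form an
   invariant multiset. *)

Set Implicit Arguments.
Unset Strict Implicit.
Unset Printing Implicit Defensive.
Import Order.TTheory.

(** * Merging and the comparisons it performs *)

Section Merge.
Context {d} {T : orderType d}.
Implicit Types (x y : T) (l : seq T).

Lemma npairC x y : npair x y = npair y x.
Proof. by rewrite /npair; case: ltgtP => // ->. Qed.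

Lemma merge_tr_nilr l : merge_tr l [::] = (l, [::]).
Proof. by case: l. Qed.

Lemma merge_tr_cons x l1 y l2 :
  merge_tr (x :: l1) (y :: l2) =
  if (x < y)%O then
    let m := merge_tr l1 (y :: l2) in (x :: m.1, npair x y :: m.2)
  else
    let m := merge_tr (x :: l1) l2 in (y :: m.1, npair x y :: m.2).
Proof.
rewrite [LHS]/=; case: ifP => _; first by case: merge_tr.
by rewrite -/(merge_tr (x :: l1) l2); case: merge_tr.
Qed.

Lemma perm_merge_tr l1 l2 : perm_eq (merge_tr l1 l2).1 (l1 ++ l2).
Proof.
elim: l1 l2 => [|x l1 IH1] l2; first exact: perm_refl.
elim: l2 => [|y l2 IH2]; first by rewrite merge_tr_nilr cats0.
rewrite merge_tr_cons; case: ifP => _ /=; first by rewrite perm_cons.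
by rewrite -cat_cons perm_sym perm_catC /= perm_cons perm_catC perm_sym.
Qed.

(** Distinctness excludes ties, the only case in which merging treats its arguments
    asymmetrically. *)
Lemma merge_trC l1 l2 :
  uniq (l1 ++ l2) -> merge_tr l1 l2 = merge_tr l2 l1.
Proof.
elim: l1 l2 => [|x l1 IH1] l2; first by rewrite merge_tr_nilr.
elim: l2 => [|y l2 IH2] Ul; first by rewrite merge_tr_nilr.
rewrite !merge_tr_cons npairC.
case: ltgtP => [xy|yx|exy].
- by rewrite IH1 //; case/andP: Ul.
- rewrite IH2 //; move: Ul; rewrite uniq_catC /= => /andP[_].
  by rewrite -[x :: _]/(x :: l1) uniq_catC.
- by move: Ul; rewrite /= exy mem_cat mem_head orbT.
Qed.

End Merge.

(** * Descendants in the binary tree of indices *)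

Definition desc (c i : nat) := exists e, i %/ 2 ^ e = c.

Lemma desc_refl c : desc c c.
Proof. by exists 0; rewrite divn1. Qed.

Lemma desc_leq c i : desc c i -> c <= i.
Proof. by case=> e <-; apply: leq_div. Qed.

Lemma desc_gtF c i : i < c -> ~ desc c i.
Proof. by move=> ic /desc_leq; rewrite leqNgt ic. Qed.

Lemma desc_neq c i j : j < c -> desc c i -> i != j.
Proof. by move=> jc /desc_leq ci; rewrite neq_ltn (leq_trans jc ci) orbT. Qed.

Lemma desc_child c j i : c %/ 2 = j -> desc c i -> desc j i.
Proof. by move=> <- [e <-]; exists e.+1; rewrite expnSr divnMA. Qed.

(** Otherwise one sibling would be a proper ancestor of the other, hence at most its own half, which
    is impossible for a positive index. *)
Lemma desc_sibling c c' i :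
  0 < c %/ 2 -> c %/ 2 = c' %/ 2 -> c != c' -> desc c i -> ~ desc c' i.
Proof.
have W b b' : 0 < b %/ 2 -> b %/ 2 = b' %/ 2 -> b != b' ->
    forall e a, i %/ 2 ^ e = b -> i %/ 2 ^ (e + a) = b' -> False.
  move=> b0 bb' ne e [|a] Hb; first by rewrite addn0 Hb => /eqP; rewrite (negbTE ne).
  rewrite expnD divnMA Hb expnS divnMA bb' => Hb'.
  have := leq_div (b' %/ 2) (2 ^ a); lia.
move=> c0 cc' ne [e He] [e' He'].
case: (leqP e e') => le.
  by apply: (W c c' c0 cc' ne e (e' - e)); rewrite ?subnKC.
by apply: (W c' c _ _ _ e' (e - e')); rewrite -?cc' 1?eq_sym ?subnKC // ltnW.
Qed.

(** * The heap as a tree of pending merges *)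

Section WeakHeap.
Context {d} {T : orderType d} (x0 : T) (n : nat).
Implicit Types (st : @whstate d T).

Local Notation get := (get x0).

Definition active st i := (i < n) && abit st i.

Lemma has_leftE st i : 0 < i -> has_left n st i = active st (leftc st i).
Proof. by rewrite /has_left lt0n => ->. Qed.

Lemma has_rightE st i : has_right n st i = active st (rightc st i).
Proof. by []. Qed.

Lemma parent_leftc st i : leftc st i %/ 2 = i.
Proof. rewrite /leftc; case: rbit => /=; lia. Qed.

Lemma parent_rightc st i : rightc st i %/ 2 = i.
Proof. rewrite /rightc; case: rbit => /=; lia. Qed.

Lemma ltn_leftc st i : 0 < i -> i < leftc st i.
Proof. rewrite /leftc; lia. Qed.

Lemma ltn_rightc st i : 0 < i -> i < rightc st i.
Proof. rewrite /rightc; case: rbit => /=; lia. Qed.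

Lemma leftc_neq_rightc st i : leftc st i != rightc st i.
Proof. rewrite /rightc /leftc; case: rbit => /=; lia. Qed.

(* What remains of the output of the merge performed at node [i] of the merge
   tree once its current head, stored at the distinguished ancestor of [i],
   has been taken away, and the comparisons still to be done below [i]. *)
Fixpoint todo (h : nat) st (i : nat) : seq T * seq (T * T) :=
  if h isn't h'.+1 then ([::], [::]) else
  if active st i then
    let L := todo h' st (leftc st i) in
    let R := todo h' st (rightc st i) in
    let M := merge_tr L.1 (get st i :: R.1) in
    (M.1, L.2 ++ R.2 ++ M.2)
  else ([::], [::]).

Lemma todo_inactive h st i : ~~ active st i -> todo h st i = ([::], [::]).
Proof. by case: h => //= h /negbTE ->. Qed.

Lemma todo_active h st i : active st i ->
  todo h.+1 st i =
  let L := todo h st (leftc st i) in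
  let R := todo h st (rightc st i) in
  let M := merge_tr L.1 (get st i :: R.1) in
  (M.1, L.2 ++ R.2 ++ M.2).
Proof. by move=> Ai; rewrite /= Ai. Qed.

Definition agree st st' i :=
  [/\ get st' i = get st i, rbit st' i = rbit st i & abit st' i = abit st i].

Lemma eq_todo h st st' i :
  (forall j, desc i j -> agree st st' j) -> todo h st' i = todo h st i.
Proof.
elim: h i => //= h IH i A.
have [Hg Hr Ha] := A i (desc_refl i).
have El : leftc st' i = leftc st i by rewrite /leftc Hr.
have Er : rightc st' i = rightc st i by rewrite /rightc Hr.
rewrite /active Ha Hg El Er !IH // => j dj; apply: A.
  exact: desc_child (parent_rightc st i) dj.
exact: desc_child (parent_leftc st i) dj.
Qed.

Arguments todo : simpl never.

Lemma get_join st i j k : i != j ->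
  get (join x0 st i j) k =
  if (get st j < get st i)%O then
    if k == j then get st i else if k == i then get st j else get st k
  else get st k.
Proof.
by move=> ij; rewrite /join; case: ifP => // _; rewrite /get /= !nth_set_nth /= nth_set_nth.
Qed.

Lemma rbit_join st i j k :
  rbit (join x0 st i j) k = rbit st k (+) ((k == j) && (get st j < get st i)%O).
Proof.
rewrite /join; case: ifP => _; last by rewrite andbF addbF.
rewrite /rbit /= nth_set_nth /= andbT.
by case: eqP => [->|_]; rewrite ?addbT ?addbF.
Qed.

Lemma abit_join st i j k : abit (join x0 st i j) k = abit st k.
Proof. by rewrite /join; case: ifP. Qed.

Lemma tr_join st i j :
  wh_tr (join x0 st i j) = rcons (wh_tr st) (npair (get st i) (get st j)).
Proof. by rewrite /join; case: ifP. Qed.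

(* Performing the comparison of a merge node: the winner goes to [v], and the
   flipped reverse bit makes the stream of the winner the left one. *)
Lemma todo_join h st v j :
  0 < j -> v < j -> active st j ->
  let L := todo h st (leftc st j) in
  let R := todo h st (rightc st j) in
  let M := merge_tr (get st v :: L.1) (get st j :: R.1) in
  let st' := join x0 st v j in
  uniq M.1 ->
  M.1 = get st' v :: (todo h.+1 st' j).1 /\
  forall p, count p (wh_tr st') + count p (todo h.+1 st' j).2 =
            count p (wh_tr st) + count p L.2 + count p R.2 + count p M.2.
Proof.
move=> j0 vj Aj L R M st' UM.
have vj' : v != j by lia.
have U : uniq ((get st v :: L.1) ++ get st j :: R.1).
  by rewrite -(perm_uniq (perm_merge_tr _ _)).
have ne : get st v != get st j.
  by move: U => /= /andP[+ _]; rewrite mem_cat inE !negb_or => /and3P[].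
(* The join writes only at [v] and [j], both smaller than every descendant of a child of [j]. *)
have fr c : c %/ 2 = j -> todo h st' c = todo h st c.
  move=> cj; apply: eq_todo => i /desc_leq ci; split.
  - rewrite get_join //; case: ifP => // _.
    by have [-> ->] : (i == j) = false /\ (i == v) = false by lia.
  - rewrite rbit_join; have -> : (i == j) = false by lia.
    exact: addbF.
  - exact: abit_join.
have Aj' : active st' j by rewrite /active abit_join.
rewrite (todo_active h Aj') !get_join // eqxx (negbTE vj') tr_join.
rewrite !fr ?parent_leftc ?parent_rightc //.
rewrite /leftc /rightc rbit_join eqxx -/st' /=.
move: ne; case: ltgtP => // [gjv|gvj] _; last first.
  rewrite addbF /M merge_tr_cons gvj /= -/(leftc st j) -/(rightc st j) -/L -/R.
  by split=> // p; rewrite -cats1 !count_cat /=; lia.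
rewrite addbT.
have -> : 2 * j + ~~ rbit st j = rightc st j by rewrite /rightc; case: rbit => /=; lia.
have -> : 2 * j + 1 - ~~ rbit st j = leftc st j by rewrite /leftc; case: rbit => /=; lia.
rewrite -/L -/R /M merge_trC // merge_tr_cons gjv /=.
by split=> // p; rewrite -cats1 !count_cat /= npairC; lia.
Qed.

(** * Hole filling and extraction *)

(* The body of [fill] with an arbitrary start [y] of the special path, so that
   the loop can be unfolded one step down the path at a time. *)
Definition pathfill (f g : nat) st (v y : nat) :=
  let p := lpath n g st y in
  let x := last v p in
  let mid := take (size p).-1 p in
  let st1 := write x0 st v (get st x) in
  let st2 := if has_right n st1 x then fill x0 n f st1 x else deactivate st1 x in
  foldl (fun st y => join x0 st v y) st2 (rev mid).

Lemma fillE f st v :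
  fill x0 n f.+1 st v =
  if has_right n st v then pathfill f n st v (rightc st v) else deactivate st v.
Proof. by rewrite /=; case: has_right. Qed.

Lemma lpath_neq_nil g st y : exists z p, lpath n g st y = z :: p.
Proof. by case: g => [|g] /=; [|case: has_left]; eexists; eexists. Qed.

(** Joins run bottom-up, so the topmost node [y] is joined last. *)
Lemma pathfill_left f g st v y : has_left n st y ->
  pathfill f g.+1 st v y = join x0 (pathfill f g st v (leftc st y)) v y.
Proof.
move=> Hl; rewrite /pathfill /= Hl.
have [z [p ->]] := lpath_neq_nil g st (leftc st y).
by rewrite /= rev_cons foldl_rcons.
Qed.

Lemma pathfill_nil f g st v y : ~~ has_left n st y ->
  pathfill f g st v y =
  let st1 := write x0 st v (get st y) in
  if has_right n st1 y then fill x0 n f st1 y else deactivate st1 y.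
Proof. by rewrite /pathfill; case: g => [|g] /= => [|/negbTE ->]. Qed.

(** The hole at [v] receives the next output of the merge at [y]. The first two clauses confine the
    changes to [v] and the subtree of [y], so that pending merges elsewhere survive. *)
Lemma pathfill_spec h f g st v y :
  h <= f -> h <= g -> h <= n -> 0 < y -> v < y -> n <= y * 2 ^ h ->
  active st y -> uniq (todo h st y).1 ->
  let st' := pathfill f g st v y in
  [/\ forall i, ~ desc y i -> i != v -> get st' i = get st i,
      forall i, ~ desc y i -> rbit st' i = rbit st i /\ abit st' i = abit st i,
      (todo h st y).1 = get st' v :: (todo h st' y).1 &
      forall p, count p (wh_tr st') + count p (todo h st' y).2 =
                count p (wh_tr st) + count p (todo h st y).2].
Proof.
elim: h f g st v y => [|h IH] f g st v y hf hg hn y0 vy ny Ay.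
  by move: Ay; rewrite muln1 in ny; rewrite /active ltnNge ny.
have lP := parent_leftc st y; have rP := parent_rightc st y.
have yl := ltn_leftc st y0; have yr := ltn_rightc st y0.
have vl := ltn_trans vy yl; have vr := ltn_trans vy yr.
have child_height c : c %/ 2 = y -> n <= c * 2 ^ h.
  move=> cy; apply: leq_trans ny _; rewrite expnS mulnA leq_mul2r -cy.
  by rewrite leq_divM orbT.
have nl := child_height _ lP; have nr := child_height _ rP.
have vy' : v != y by rewrite neq_ltn vy.
have yv : y != v by rewrite eq_sym.
rewrite (todo_active h Ay).
set L := todo h st (leftc st y); set R := todo h st (rightc st y) => /= UM.
have UC : uniq (L.1 ++ get st y :: R.1).
  by rewrite -(perm_uniq (perm_merge_tr _ _)).
(* If the left input is not exhausted, its next head is first brought to [v]; the join at [y] then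
   compares it with [s_y]. *)
have [Hl|Hl] := boolP (has_left n st y).
  case: g hg => // g hg.
  rewrite pathfill_left //; rewrite has_leftE // in Hl.
  have UL : uniq L.1 by move: UC; rewrite cat_uniq => /and3P[].
  have := IH f g st v (leftc st y) (ltnW hf) hg (ltnW hn)
             (leq_ltn_trans (leq0n y) yl) vl nl Hl UL.
  set st1 := pathfill f g st v (leftc st y) => -[F1 F2 EL CL].
  have ndy := desc_gtF yl.
  have Ey : get st1 y = get st y by apply: F1.
  have [Er Ea] := F2 y ndy.
  have El : leftc st1 y = leftc st y by rewrite /leftc Er.
  have Err : rightc st1 y = rightc st y by rewrite /rightc Er.
  have ER : todo h st1 (rightc st y) = R.
    apply: eq_todo => i di.
    have nd : ~ desc (leftc st y) i.
      apply: (desc_sibling _ _ _ di); rewrite ?lP ?rP //.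
      by rewrite eq_sym leftc_neq_rightc.
    have [? ?] := F2 i nd; split=> //; apply: F1 => //.
    exact: desc_neq vr di.
  have Ay1 : active st1 y by rewrite /active Ea.
  have := todo_join (h := h) y0 vy Ay1; cbv zeta.
  rewrite El Err ER Ey -EL => /(_ UM) [EM CM].
  have descF i : ~ desc y i -> (i == y) = false.
    by move=> ndi; apply/eqP => iy; apply: ndi; rewrite iy; exact: desc_refl.
  split=> //.
  - move=> i ndi iv; rewrite get_join // (descF i ndi) (negbTE iv) if_same.
    by apply: F1 => // /(desc_child lP).
  - move=> i ndi; rewrite rbit_join abit_join (descF i ndi) addbF.
    by apply: F2 => /(desc_child lP).
  - by move=> p; rewrite (CM p) (CL p) !count_cat !addnA.
(* The left input is exhausted: [s_y] is output without a comparison, and the right input, if any,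
   supplies the next head at [y]. *)
rewrite pathfill_nil //; rewrite has_leftE // in Hl.
have EL : L = ([::], [::]) by rewrite /L todo_inactive.
rewrite EL /=.
set st1 := write x0 st v (get st y).
have G1 i : get st1 i = if i == v then get st y else get st i.
  by rewrite /get /= nth_set_nth.
have ER : todo h st1 (rightc st y) = R.
  by apply: eq_todo => i di; split=> //; rewrite G1 (negbTE (desc_neq vr di)).
rewrite has_rightE -[rightc st1 y]/(rightc st y).
case: ifP => Hr; last first.
  have RE : R = ([::], [::]) by rewrite /R todo_inactive //; apply/negbT.
  have Ad : ~~ active (deactivate st1 y) y.
    by rewrite /active /abit /= nth_set_nth /= eqxx andbF.
  rewrite RE (todo_inactive _ Ad); split=> //=.
  - by move=> i ndi iv; rewrite -[LHS]/(get st1 i) G1 (negbTE iv).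
  - move=> i ndi; split=> //; rewrite /abit /= nth_set_nth /=.
    by case: eqP => // iy; case: ndi; rewrite iy; exact: desc_refl.
  - by rewrite -[get (deactivate _ _) v]/(get st1 v) G1 eqxx.
have h0 : 0 < h.
  by case: (h) nr => //; rewrite muln1 => nr0; move: Hr; rewrite /active ltnNge nr0.
have hf0 : 0 < f by rewrite (leq_trans _ hf).
have UR : uniq (todo h st1 (rightc st y)).1.
  by rewrite ER; move: UC; rewrite EL /= => /andP[].
have hf' : h <= f.-1 by rewrite -ltnS prednK.
(* The hole is now at [y], which takes the role of [v]; the new special path starts with fresh fuel
   [n]. *)
have := IH f.-1 n st1 y (rightc st y) hf' (ltnW hn) (ltnW hn)
           (leq_ltn_trans (leq0n y) yr) yr nr Hr UR.
have -> : fill x0 n f st1 y = pathfill f.-1 n st1 y (rightc st y).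
  by rewrite -{1}(prednK hf0) fillE has_rightE Hr.
set st2 := pathfill _ _ _ _ _; rewrite ER => -[F1 F2 E2 C2].
have [Er Ea] := F2 y (desc_gtF yr).
have El : leftc st2 y = leftc st y by rewrite /leftc Er.
have Err : rightc st2 y = rightc st y by rewrite /rightc Er.
have EL2 : todo h st2 (leftc st y) = ([::], [::]).
  apply: todo_inactive; rewrite /active.
  have [|_ ->//] := F2 (leftc st y).
  apply: (desc_sibling _ _ _ (desc_refl _)); rewrite ?lP ?rP //.
  exact: leftc_neq_rightc.
have A2 : active st2 y by rewrite /active Ea.
rewrite (todo_active h A2) El Err EL2 /=; split.
- move=> i ndi iv; rewrite F1 ?G1 ?(negbTE iv) //; first by move/(desc_child rP).
  by apply/eqP => iy; apply: ndi; rewrite iy; exact: desc_refl.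
- by move=> i ndi; apply: F2 => /(desc_child rP).
- by rewrite -E2 F1 ?G1 ?eqxx //; exact: desc_gtF.
- by move=> p; rewrite !cats0; exact: C2.
Qed.

(** Index 0 holds the current head of the merge at node 1. The fuel covers one round per remaining
    output and a last one that deactivates the root. *)
Lemma extract_count h f st p :
  h < n -> n <= 2 ^ h -> ~~ rbit st 0 -> abit st 0 ->
  uniq (todo h st 1).1 -> size (todo h st 1).1 < f ->
  count p (wh_tr (extract x0 n f st)) =
  count p (wh_tr st) + count p (todo h st 1).2.
Proof.
move=> hn nh; elim: f st => // f IH st r0 a0 U.
have n0 : 0 < n by apply: leq_ltn_trans hn.
have rE : rightc st 0 = 1 by rewrite /rightc (negbTE r0).
have fE : fill x0 n n st 0 =
    if active st 1 then pathfill n.-1 n st 0 1 else deactivate st 0.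
  by rewrite -{2}(prednK n0) fillE has_rightE rE.
rewrite ltnS /= a0 fE; case: ifP => A1; last first.
  rewrite todo_inactive ?A1 // addn0 => _.
  by case: (f) => //= f'; rewrite /abit /=; case: (wh_a st).
have hn1 : h <= n.-1 by rewrite -ltnS prednK.
have nh1 : n <= 1 * 2 ^ h by rewrite mul1n.
have := pathfill_spec hn1 (ltnW hn) (ltnW hn) (ltn0Sn 0) (ltn0Sn 0) nh1 A1 U.
set st' := pathfill _ _ _ _ _ => -[_ F2 E C] sz.
have nd0 : ~ desc 1 0 by exact: desc_gtF.
have [r0' a0'] := F2 0 nd0.
rewrite -C; apply: IH; rewrite ?r0' ?a0' //.
- by move: U; rewrite E => /andP[].
- by move: sz; rewrite E.
Qed.

End WeakHeap.

(** * The distinguished ancestor under zero reverse bits *)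

(* The distinguished ancestor of [j] when all reverse bits are 0: half of the odd
   part of [j]. It is also defined on the virtual leaves [n <= j < 2 n], where
   it tells which array element sits at the leaf. *)
Definition dista (j : nat) := j`_2^' %/ 2.

Lemma partn2'E j : j`_2^' = (2 * dista j).+1.
Proof.
have : odd j`_2^' by have := part_pnat 2^' j; rewrite p'natE // dvdn2 negbK.
rewrite /dista; lia.
Qed.

Lemma dista_double j : 0 < j -> dista (2 * j) = dista j.
Proof.
by move=> j0; rewrite /dista partnM // (@part_p'nat _ 2) ?mul1n.
Qed.

Lemma dista_odd j : dista (2 * j).+1 = j.
Proof.
rewrite /dista part_pnat_id; first by lia.
by rewrite p'natE // dvdn2; lia.
Qed.

Lemma leq_dista j : 0 < j -> (2 * dista j).+1 <= j.
Proof. by move=> j0; rewrite -partn2'E dvdn_leq ?dvdn_part. Qed.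

Lemma ltn_dista j : 0 < j -> dista j < j.
Proof. move/leq_dista; lia. Qed.

(** Equal values mean equal odd parts, so [i] and [j] differ by a power of 2, and the bounds leave
    only the power 1. *)
Lemma dista_inj i j : i < 2 * j -> j < 2 * i -> dista i = dista j -> i = j.
Proof.
have W a b m o : 0 < m -> m = 2 ^ a * o -> a < b -> 2 * m <= 2 ^ b * o.
  by move=> m0 -> ab; rewrite mulnA leq_mul2r -expnS leq_exp2l // ab orbT.
move=> Hi Hj E.
have i0 : 0 < i by lia.
have j0 : 0 < j by lia.
have := partnC 2 i0; have := partnC 2 j0; rewrite !partn2'E !p_part E => Ej Ei.
case: (ltngtP (logn 2 i) (logn 2 j)) => lij; last by rewrite lij Ej in Ei.
- have := W _ _ _ _ i0 (esym Ei) lij; rewrite Ej; lia.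
- have := W _ _ _ _ j0 (esym Ej) lij; rewrite Ei; lia.
Qed.

(** * Mergesort as a complete binary tree *)

Section MergesortTree.
Context {d} {T : orderType d} (g : nat -> T).

(** Nodes are numbered as in the heap; the leaves below [i] are the indices from [i * 2 ^ h] to
    [i.+1 * 2 ^ h - 1]. *)
Fixpoint mstree (h i : nat) : seq T * seq (T * T) :=
  if h isn't h'.+1 then ([:: g i], [::]) else
  let L := mstree h' (2 * i) in
  let R := mstree h' (2 * i).+1 in
  let M := merge_tr L.1 R.1 in
  (M.1, L.2 ++ R.2 ++ M.2).

Lemma iota_halves h i :
  iota (i * 2 ^ h.+1) (2 ^ h.+1) =
  iota ((2 * i) * 2 ^ h) (2 ^ h) ++ iota ((2 * i).+1 * 2 ^ h) (2 ^ h).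
Proof.
rewrite [(2 * i).+1 * _]mulSn [2 ^ h + _]addnC -iotaD addnn -mul2n -expnS.
by rewrite expnS mulnCA mulnA.
Qed.

(** Halving a power of 2 is exact, so the recursive calls sort the leaves below the two children. *)
Lemma msort_trE f h i : h <= f ->
  msort_tr f [seq g j | j <- iota (i * 2 ^ h) (2 ^ h)] = mstree h i.
Proof.
elim: h f i => [|h IH] f i; first by case: f => [|f] _ /=; rewrite muln1.
case: f => // f hf; rewrite iota_halves map_cat /= size_cat !size_map !size_iota leEnat.
have h0 : 0 < 2 ^ h by rewrite expn_gt0.
have -> : (2 ^ h + 2 ^ h <= 1) = false by lia.
have -> : (2 ^ h + 2 ^ h) %/ 2 = 2 ^ h by lia.
rewrite take_size_cat ?drop_size_cat ?size_map ?size_iota // !IH //.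
by case: mstree => sl tl; case: mstree => sr tr /=; case: merge_tr.
Qed.

Lemma perm_mstree h i :
  perm_eq (mstree h i).1 [seq g j | j <- iota (i * 2 ^ h) (2 ^ h)].
Proof.
elim: h i => [|h IH] i; first by rewrite /= muln1.
rewrite iota_halves map_cat /=; apply: perm_trans (perm_merge_tr _ _) _.
exact: perm_cat.
Qed.

End MergesortTree.

(** * The construction phase *)

Section Construction.
Context {d} {T : orderType d} (x0 : T) (k : nat) (l : seq T).
Implicit Types (st : @whstate d T).

Local Notation get := (get x0).
Local Notation n := (2 ^ k).
Local Notation todo := (todo x0 n).

(** The distance from [i] down to the leaf level [n], ..., [2 n - 1]. *)
Definition height i := k - trunc_log 2 i.

Lemma trunc_log_lt i : 0 < i -> i < n -> trunc_log 2 i < k.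
Proof.
move=> i0 ik; rewrite -(ltn_exp2l _ _ (isT : 1 < 2)).
exact: leq_ltn_trans (trunc_logP _ _) ik.
Qed.

Lemma height_double i : 0 < i -> i < n -> height i = (height (2 * i)).+1.
Proof.
move=> i0 ik; have := trunc_log_lt i0 ik.
rewrite /height mul2n trunc_log2_double //; lia.
Qed.

Lemma height_double1 i : 0 < i -> i < n -> height i = (height (2 * i).+1).+1.
Proof.
move=> i0 ik; have := trunc_log_lt i0 ik; rewrite /height.
have -> : trunc_log 2 (2 * i).+1 = (trunc_log 2 i).+1.
  by rewrite trunc_log2S; [congr (trunc_log 2 _).+1|]; lia.
lia.
Qed.

Lemma height_leaf i : n <= i -> height i = 0.
Proof. by move=> ni; apply/eqP; rewrite subn_eq0 trunc_log_max. Qed.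

Lemma height_bounds i : 0 < i -> i < n ->
  n <= i * 2 ^ height i /\ i.+1 * 2 ^ height i <= n + n.
Proof.
move=> i0 ik; have /andP[lo hi] := trunc_log_bounds (isT : 1 < 2) i0.
have E : n = 2 ^ trunc_log 2 i * 2 ^ height i.
  by rewrite -expnD subnKC // ltnW // trunc_log_lt.
rewrite E -mulnDl !leq_mul2r addnn -mul2n -expnS.
by rewrite lo hi !orbT.
Qed.

(** Climbing from [j] consults only bits of smaller indices, still 0 when [j] is joined. *)
Lemma dancestorE f st j : 0 < j -> j <= f ->
  (forall i, i < j -> rbit st i = false) -> dancestor f st j = dista j.
Proof.
elim: f j => [|f IH] j j0 jf r0; first by lia.
rewrite /= /is_leftc /leftc /parent r0 ?addn0; last by lia.
case: eqP => [ej|nej].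
  rewrite IH; try lia; last by move=> i ij; apply: r0; lia.
  by rewrite [in RHS]ej dista_double //; lia.
have -> : j = (2 * (j %/ 2)).+1 by lia.
rewrite dista_odd; lia.
Qed.

Let ms := mstree (fun i => nth x0 l (dista i)).

(* After the joins at the nodes of index greater than [j], the maximal finished subtrees are
   those rooted at [j + 1, ..., 2 j + 1]. *)
Definition constructed j st :=
  [/\ forall i, i <= j -> rbit st i = false,
      forall i, i < n -> abit st i,
      forall i, j < i <= (2 * j).+1 ->
        get st (dista i) :: (todo (height i) st i).1 = (ms (height i) i).1 &
      forall p, count p (wh_tr st)
          + \sum_(j.+1 <= i < (2 * j).+2) count p (todo (height i) st i).2
        = \sum_(j.+1 <= i < (2 * j).+2) count p (ms (height i) i).2].

Hypothesis Ul : uniq [seq nth x0 l (dista i) | i <- iota n n].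

Lemma uniq_ms i : 0 < i < n -> uniq (ms (height i) i).1.
Proof.
case/andP=> i0 ik; rewrite (perm_uniq (perm_mstree _ _ _)).
have [lo hi] := height_bounds i0 ik.
apply: subseq_uniq Ul; apply: map_subseq.
rewrite -(subnKC lo); set a := _ - n.
have -> : iota n n = iota n a ++ iota (n + a) (n - a).
  by rewrite -iotaD subnKC // /a; move: hi; rewrite mulSn; lia.
apply: subseq_trans (suffix_subseq _ _).
have -> : n - a = 2 ^ height i + (n - a - 2 ^ height i).
  by move: hi; rewrite mulSn /a; lia.
by rewrite iotaD prefix_subseq.
Qed.

Lemma constructed_init : constructed n.-1 (init_state n l).
Proof.
have n0 : 0 < n by rewrite expn_gt0.
split.
- by move=> i _; rewrite /rbit /= nth_nseq if_same.
- by move=> i ik; rewrite /abit /= nth_nseq ik.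
(* Initially the finished subtrees are leaves: one element, no comparison. *)
- by move=> i /andP[ni _]; rewrite height_leaf //; lia.
- move=> p; rewrite add0n; apply: eq_big_nat => i /andP[ni _].
  by rewrite height_leaf //; lia.
Qed.

Lemma constructed_join j st : 0 < j < n -> constructed j st ->
  constructed j.-1 (join x0 st (dancestor j st j) j).
Proof.
move=> j0n [r0 a1 S C]; have /andP[j0 jn] := j0n.
rewrite dancestorE //; last by move=> i /ltnW /r0.
have dj := ltn_dista j0.
set st' := join _ _ _ _.
have hl := height_double j0 jn.
have hr : height (2 * j).+1 = height (2 * j).
  by apply: succn_inj; rewrite -hl -height_double1.
have lE : leftc st j = 2 * j by rewrite /leftc r0 // addn0.
have rE : rightc st j = (2 * j).+1 by rewrite /rightc r0 // subn0 addn1.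
(* The heads of the two inputs are at [dista j] and [j], the positions that the join compares. *)
have Sl := S (2 * j); rewrite dista_double // in Sl.
have Sr := S (2 * j).+1; rewrite dista_odd hr in Sr.
have Aj : active n st j by rewrite /active jn a1.
have msE : ms (height j) j =
    let M := merge_tr (ms (height (2 * j)) (2 * j)).1
                      (ms (height (2 * j)) (2 * j).+1).1 in
    (M.1, (ms (height (2 * j)) (2 * j)).2 ++
          (ms (height (2 * j)) (2 * j).+1).2 ++ M.2) by rewrite hl.
have := todo_join (x0 := x0) (h := height (2 * j)) j0 dj Aj; cbv zeta.
rewrite lE rE Sl ?Sr; try lia.
have -> : (merge_tr (ms (height (2 * j)) (2 * j)).1
             (ms (height (2 * j)) (2 * j).+1).1).1 = (ms (height j) j).1.
  by rewrite msE.
move=> /(_ (uniq_ms j0n)); rewrite -hl -/st' => -[Ej Cj].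
have fr i : j < i -> todo (height i) st' i = todo (height i) st i.
  move=> ji; apply: eq_todo => i' di; have ij := desc_neq ji di.
  have id := desc_neq (ltn_trans dj ji) di; split.
  - rewrite get_join ?(ltn_eqF dj) // (negbTE ij) (negbTE id); exact: if_same.
  - by rewrite rbit_join (negbTE ij) addbF.
  - exact: abit_join.
have ne : dista j != j by rewrite (ltn_eqF dj).
split.
- move=> i ij; rewrite rbit_join r0; last by lia.
  by have -> : (i == j) = false by lia.
- by move=> i ik; rewrite abit_join a1.
- move=> i /andP[ji ij].
  have [->//|ij'] := eqVneq i j.
  have {}ji : j < i by lia.
  have ii : j < i <= (2 * j).+1 by lia.
  rewrite fr // -S // get_join //.
  (* By injectivity of [dista] on [j + 1], ..., [2 j + 1], no other finished subtree keeps its head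
     at [j] or [dista j]. *)
  have -> : (dista i == j) = false.
    apply/eqP => e; suff : i = (2 * j).+1 by lia.
    by apply: dista_inj; rewrite ?dista_odd //; lia.
  have -> : (dista i == dista j) = false.
    apply/eqP => e; suff : i = 2 * j by lia.
    by apply: dista_inj; rewrite ?dista_double //; lia.
  by rewrite if_same.
- move=> p; have := C p; have := Cj p.
  (* The sums lose the terms of [2 j] and [2 j + 1] and gain that of [j]. *)
  have -> : (2 * j.-1).+2 = 2 * j by lia.
  rewrite (prednK j0) !(big_nat_recr _ j.+1) /=; try lia.
  have jj : j < 2 * j by lia.
  rewrite !(big_ltn jj) hr.
  rewrite (eq_big_nat _ _ (F1 := fun i => count p (todo (height i) st' i).2)
    (F2 := fun i => count p (todo (height i) st i).2)).
    by rewrite msE /= !count_cat; lia.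
  by move=> i /andP[ji _]; rewrite fr.
Qed.

Lemma construct_spec : constructed 0 (construct x0 n (init_state n l)).
Proof.
have : n.-1 < n by rewrite prednK ?expn_gt0.
rewrite /construct; have := constructed_init; move: (init_state n l) => st.
elim: n.-1 st => // j IH st C jn.
rewrite -[j.+1]addn1 iotaD rev_cat /=.
by apply: IH (ltnW jn); apply: (constructed_join (j := j.+1)).
Qed.

End Construction.

(** * Equality of the two multisets of comparisons *)

Lemma weakheapsort_traceE {d} {T : orderType d} (x0 : T) (l : seq T) (k : nat) :
  size l = 2 ^ k -> uniq [seq nth x0 l (dista i) | i <- iota (2 ^ k) (2 ^ k)] ->
  perm_eq (weakheapsort_trace l)
    (mergesort_trace [seq nth x0 l (dista i) | i <- iota (2 ^ k) (2 ^ k)]).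
Proof.
case: l => [|x l] sl Ul; first by move: (expn_gt0 2 k); rewrite -sl.
have nE i : 2 ^ k <= i < 2 * 2 ^ k -> nth x0 (x :: l) (dista i) = nth x (x :: l) (dista i).
  move=> /andP[ki ik]; apply: set_nth_default; rewrite sl.
  have i0 : 0 < i by apply: leq_trans ki; rewrite expn_gt0.
  have := leq_dista i0; lia.
have gE : [seq nth x0 (x :: l) (dista i) | i <- iota (2 ^ k) (2 ^ k)] =
          [seq nth x (x :: l) (dista i) | i <- iota (2 ^ k) (2 ^ k)].
  by apply/eq_in_map => i; rewrite mem_iota => ik; apply: nE; rewrite mul2n -addnn.
rewrite {}gE in Ul *.
set g := fun i => nth x (x :: l) (dista i).
(* For [j = 0] the only finished root is node 1; its pending comparisons are those that extraction
   performs. *)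
have [r0 a1 S C] := construct_spec Ul.
set st := construct _ _ _ in r0 a1 S C.
have h1 : height k 1 = k by rewrite /height subn0.
have := S 1 isT; have := fun p => C p.
rewrite h1.
rewrite /mergesort_trace size_map size_iota.
have -> : iota (2 ^ k) (2 ^ k) = iota (1 * 2 ^ k) (2 ^ k) by rewrite mul1n.
have kf : k <= 2 ^ k by rewrite ltnW // ltn_expl.
rewrite (msort_trE g 1 kf) => C1 S1.
apply/seq.permP => p; rewrite /weakheapsort_trace sl -/st.
have U1 : uniq (mstree g k 1).1.
  by rewrite (perm_uniq (perm_mstree g k 1)) mul1n.
have Ut : uniq (todo x (2 ^ k) k st 1).1.
  by move: U1; rewrite -S1 => /andP[].
have szt : size (todo x (2 ^ k) k st 1).1 < 2 ^ k.
  have /perm_size := perm_mstree g k 1.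
  by rewrite -S1 size_map size_iota => /eq_leq.
have rt : ~~ rbit st 0 by rewrite r0.
have at0 : abit st 0 by rewrite a1 // expn_gt0.
rewrite (extract_count p (ltn_expl k (ltnSn 1)) (leqnn _) rt at0 Ut szt).
by have := C1 p; rewrite !big_nat1 h1.
Qed.

Theorem theorem3 (k : nat) :
  exists pi : 'S_(2 ^ k),
    forall (d : Order.disp_t) (T : orderType d) (s : 'I_(2 ^ k) -> T),
      injective s ->
      perm_eq (weakheapsort_trace [seq s i | i <- enum 'I_(2 ^ k)])
              (mergesort_trace [seq s (pi i) | i <- enum 'I_(2 ^ k)]).
Proof.
(* The permutation sends [i] to the array position of the element at leaf [2 ^ k + i]. *)
have dP (i : 'I_(2 ^ k)) : dista (2 ^ k + i) < 2 ^ k.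
  have i0 : 0 < 2 ^ k + i by rewrite addn_gt0 expn_gt0.
  have := leq_dista i0; have := ltn_ord i; lia.
have pi_inj : injective (fun i => Ordinal (dP i)).
  move=> i j [/dista_inj E]; apply/val_inj/(@addnI (2 ^ k))/E.
  - by have := ltn_ord i; lia.
  - by have := ltn_ord j; lia.
exists (perm pi_inj) => d T s s_inj.
have i0 : 'I_(2 ^ k) by exists 0; rewrite expn_gt0.
set l := [seq s i | i <- enum 'I_(2 ^ k)].
have sl : size l = 2 ^ k by rewrite size_map size_enum_ord.
have -> : [seq s (perm pi_inj i) | i <- enum 'I_(2 ^ k)] =
    [seq nth (s i0) l (dista i) | i <- iota (2 ^ k) (2 ^ k)].
  rewrite -[X in iota X _]addn0 iotaDl -map_comp.
  rewrite -val_enum_ord -map_comp; apply: eq_map => i /=.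
  rewrite permE (nth_map i0) ?size_enum_ord //; congr s; apply: val_inj.
  by rewrite /= nth_enum_ord.
apply: weakheapsort_traceE => //.
rewrite map_inj_in_uniq ?iota_uniq // => i j; rewrite !mem_iota => Hi Hj.
have iP m : 2 ^ k <= m < 2 ^ k + 2 ^ k -> dista m < size l.
  move=> Hm; rewrite sl; have := dP (Ordinal (_ : m - 2 ^ k < 2 ^ k)).
  by rewrite /= subnKC; last (by case/andP: Hm); apply; lia.
have Ul : uniq l by rewrite (map_inj_uniq s_inj) enum_uniq.
move/eqP; rewrite (nth_uniq _ (iP i Hi) (iP j Hj) Ul) => /eqP.
by apply: dista_inj; lia.
Qed.
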